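(* Let $q$ be a prime power. Assume that $n$ is odd and $(n-1)\mid(q^2-1)$. Put $k=\lfloor\frac{n+q-1}{q+1}\rfloor$ and $i_{\min}=\min\left(\lfloor\frac{n-q}{2}\rfloor-k,\;q-1\right)$. Assume further that $(n-1)\mid k(q+1)$. Then, for any $1\le k'\le k+i_{\min}+1$ and each integer $j$ with $0\le j\le k'-\sharp\Delta_{k'}$, there exists an AMDS linear code $C$ with parameters $[n+2,k',n-k'+2]_{q^2}$ such that $\dim(\mathrm{Hull}_H(C))=j$.
   Context: An $[n,k,d]_{q^2}$ code is a linear code over $\mathbb{F}_{q^2}$ of length $n$, dimension $k$ and minimum Hamming distance $d$; it is AMDS (almost MDS) if $d=n-k$. The Hermitian inner product on $\mathbb{F}_{q^2}^n$ is $\langle x,y\rangle_H=\sum_i x_iy_i^q$, $C^{\perp_H}$ is the dual of $C$ with respect to it, and $\mathrm{Hull}_H(C)=C\cap C^{\perp_H}$. Definition of $\Delta_m$: let $\alpha_1,\dots,\alpha_{n-1}$ be the $n-1$ distinct elements of $\mathbb{F}_{q^2}$ with $\alpha_i^{n-1}=1$, let $\alpha_n=0$, put $u_i=\prod_{j\ne i}(\alpha_i-\alpha_j)^{-1}$ for $1\le i\le n$ (these lie in $\mathbb{F}_q^*$), and choose $v_i\in\mathbb{F}_{q^2}^*$ with $v_i^{q+1}=u_i$. For $j\ge0$ put $\delta_j=\sum_{l=1}^n v_l^{q+1}\alpha_l^{j(q+1)}$ (with $0^0=1$). For $m\ge1$, $\Delta_m=\{j:0\le j\le m-1,\ \delta_j\ne0\}$,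 and $\sharp\Delta_m$ is its cardinality. *)

(* Defs.v *)
From HB Require Import structures.
From mathcomp Require Import all_boot all_order all_algebra all_field.

Set Implicit Arguments.
Unset Strict Implicit.
Unset Printing Implicit Defensive.

Import Order.TTheory GRing.Theory Num.Theory.
Local Open Scope ring_scope.

(* A linear code of length N over F is a {vspace 'rV[F]_N}. *)

Definition prime_power (q : nat) : Prop :=
  exists p e : nat, [/\ prime p, (0 < e)%N & q = (p ^ e)%N].

Section Codes.
Variables (F : finFieldType) (N : nat).
Implicit Types (x y : 'rV[F]_N) (C : {vspace 'rV[F]_N}).

Definition hamming_dist x y : nat := #|[set i : 'I_N | x 0 i != y 0 i]|.

(* A relation rather than a function: the zero code has no minimum distance. *)
Definition is_min_dist C (d : nat) : Prop :=
  (exists x y, [/\ x \in C, y \in C, x != y & hamming_dist x y = d]) /\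
  (forall x y, x \in C -> y \in C -> x != y -> (d <= hamming_dist x y)%N).

Definition has_params C (k d : nat) : Prop := \dim C = k /\ is_min_dist C d.

Definition AMDS C : Prop :=
  exists k d : nat, has_params C k d /\ d = (N - k)%N.

Definition herm (q : nat) x y : F := \sum_(i < N) x 0 i * y 0 i ^+ q.

(* x |-> herm q x y is linear, so each kernel is the set of x orthogonal to y;
   see mem_herm_dual. *)
Definition herm_dual (q : nat) C : {vspace 'rV[F]_N} :=
  (\bigcap_(y : 'rV[F]_N | y \in C)
     lker (linfun (fun x => herm q x y : F^o)))%VS.

Definition herm_hull (q : nat) C : {vspace 'rV[F]_N} :=
  (C :&: herm_dual q C)%VS.

Lemma herm_linear q y : linear (fun x => herm q x y : F^o).
Proof.
move=> a x z; rewrite /herm scaler_sumr -big_split /=.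
by apply: eq_bigr => i _; rewrite !mxE mulrDl -mulrA.
Qed.

Lemma mem_herm_dual q C x :
  reflect (forall y, y \in C -> herm q x y = 0) (x \in herm_dual q C).
Proof.
have kerE y : (x \in lker (linfun (fun z => herm q z y : F^o)))
              = (herm q x y == 0).
  pose f := GRing.isLinear.Build _ _ _ _ _ (herm_linear q y).
  pose g : {linear 'rV[F]_N -> F^o} := HB.pack (fun z => herm q z y : F^o) f.
  by rewrite memv_ker (lfunE g).
rewrite /herm_dual memvE; apply: (iffP subv_bigcapP) => h y Cy.
  by apply/eqP; rewrite -kerE memvE h.
by rewrite -memvE kerE h.
Qed.

End Codes.

Section Delta.
Variables (F : finFieldType) (q n : nat).
Implicit Types alpha v : 'I_n -> F.

(* Indices are shifted by one: alpha_1, ..., alpha_n are the values at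
   0, ..., n - 1. *)
Definition locators alpha : Prop :=
  [/\ injective alpha,
      forall i : 'I_n, (i < n.-1)%N -> alpha i ^+ n.-1 = 1
    & forall i : 'I_n, i = n.-1 :> nat -> alpha i = 0].

Definition u_coef alpha (i : 'I_n) : F :=
  \prod_(j < n | j != i) (alpha i - alpha j)^-1.

Definition multipliers alpha v : Prop :=
  forall i, v i != 0 /\ v i ^+ q.+1 = u_coef alpha i.

Definition delta alpha v (j : nat) : F :=
  \sum_(l < n) v l ^+ q.+1 * alpha l ^+ (j * q.+1).

Definition Delta alpha v (m : nat) : {set 'I_m} :=
  [set j : 'I_m | delta alpha v j != 0].

End Delta.

Definition k_par (q n : nat) : nat := ((n + q - 1) %/ q.+1)%N.

(* The first argument of the minimum can be negative, hence int; the Euclidean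
   quotient divz by 2 is the floor, also for n < q. *)
Definition i_min (q n : nat) : int :=
  Order.min (((n%:Z - q%:Z) %/ 2)%Z - (k_par q n)%:Z) (q%:Z - 1).

(* Main.v *)
(* Every entry <x^a, x^b> of the Gram matrix of the generalized Reed-Solomon
   code on the locators is a sum of u_l alpha_l^(a + q b), which vanishes unless
   n - 1 divides a + q b. When k' > 1 the hypotheses force n - 1 = k (q + 1), and
   k' <= k + q then makes the Gram matrix diagonal with entries delta_j.
   Appending the coordinates c and g c, with c the top coefficient and
   g^(q+1) = -1, leaves the Gram matrix unchanged and raises the minimum distance
   by exactly one, so the hull has dimension at least k' - #Delta. Finally, the
   hull loses exactly one dimension when a coordinate in its support is rescaled
   by an element of norm different from 1. *)
Require Import Defs.
From HB Require Import structures.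
From mathcomp Require Import all_boot all_order all_algebra all_field.
From mathcomp Require Import cyclic zify ring.
Import Order.TTheory GRing.Theory Num.Theory.
Local Open Scope ring_scope.

Set Implicit Arguments.
Unset Strict Implicit.
Unset Printing Implicit Defensive.

(** * Hamming weight, minimum distance and diagonal rescaling *)

Section MinimumDistance.
Variables (F : finFieldType) (N : nat).
Implicit Types (x y t : 'rV[F]_N) (C : {vspace 'rV[F]_N}).

Definition wt x : nat := #|[set i : 'I_N | x 0 i != 0]|.

Lemma hamming_distE x y : hamming_dist x y = wt (x - y).
Proof. by apply: eq_card => i; rewrite !inE !mxE subr_eq0. Qed.

Lemma wt_zeros x : (wt x + \sum_(i < N) (x 0 i == 0)%R = N)%N.
Proof.
rewrite /wt -sum1_card big_mkcond -big_split -[RHS](card_ord N) -sum1_card /=.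
by apply: eq_bigr => i _; rewrite inE; case: eqP.
Qed.

Lemma wt0 : wt 0 = 0%N.
Proof. by apply: eq_card0 => i; rewrite inE mxE eqxx. Qed.

Lemma is_min_dist_wt C d :
    (exists x, [/\ x \in C, x != 0 & wt x = d]) ->
    (forall x, x \in C -> x != 0 -> (d <= wt x)%N) ->
  is_min_dist C d.
Proof.
move=> [x [Cx x0 wx]] hmin; split.
  by exists x, 0; rewrite hamming_distE subr0 mem0v.
by move=> y z Cy Cz yz; rewrite hamming_distE hmin ?memvB ?subr_eq0.
Qed.

Definition scale t : 'End('rV[F]_N) := linfun (mulmxr (diag_mx t)).

Lemma scaleE t x i : scale t x 0 i = x 0 i * t 0 i.
Proof. by rewrite lfunE /= mul_mx_diag mxE. Qed.

Lemma scale_inj t : (forall i, t 0 i != 0) -> injective (scale t).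
Proof.
move=> t0 x y /matrixP exy; apply/rowP => i.
by move: (exy 0 i); rewrite !scaleE => /(mulIf (t0 i)).
Qed.

Lemma wt_scale t x : (forall i, t 0 i != 0) -> wt (scale t x) = wt x.
Proof.
move=> t0; apply: eq_card => i.
by rewrite !inE scaleE mulf_eq0 (negPf (t0 i)) orbF.
Qed.

Lemma dim_limg_inj (vT wT : vectType F) (f : 'Hom(vT, wT)) (U : {vspace vT}) :
  injective f -> \dim (f @: U) = \dim U.
Proof. by move=> /lker0P/eqP fI; rewrite limg_dim_eq // fI capv0. Qed.

Lemma has_params_scale t C k d :
  (forall i, t 0 i != 0) -> has_params C k d -> has_params (scale t @: C) k d.
Proof.
move=> t0 [dimC [[x [y [Cx Cy xy dxy]]] dmin]]; split.
  by rewrite dim_limg_inj //; apply: scale_inj.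
have dist_scale u w : hamming_dist (scale t u) (scale t w) = hamming_dist u w.
  by rewrite !hamming_distE -linearB wt_scale.
split.
  exists (scale t x), (scale t y).
  by rewrite !memv_img // dist_scale (inj_eq (scale_inj t0)).
move=> _ _ /memv_imgP[u Cu ->] /memv_imgP[w Cw ->].
by rewrite dist_scale (inj_eq (scale_inj t0)); apply: dmin.
Qed.

End MinimumDistance.

(** * The Hermitian form over the field of order q^2 and lowering the hull dimension *)

Section HermitianHull.
Variables (F : finFieldType) (q : nat).
Hypotheses (hq : prime_power q) (cardF : #|F| = (q ^ 2)%N).

Lemma prime_power_gt1 : (1 < q)%N.
Proof.
have [p [e [p_pr e_gt0 ->]]] := hq.
by rewrite -(expn0 p) ltn_exp2l ?prime_gt1.
Qed.

Lemma exprDq (a b : F) : (a + b) ^+ q = a ^+ q + b ^+ q.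
Proof.
have [p [e [p_pr e_gt0 qE]]] := hq.
have chF : p \in [pchar F].
  by apply: (@card_finPcharP F p (e * 2)); rewrite ?cardF ?qE ?expnM.
by rewrite exprDn_pchar // qE pnatX pnatE // chF.
Qed.

Lemma exprqq (a : F) : a ^+ q ^+ q = a.
Proof. by rewrite -exprM mulnn -cardF expf_card. Qed.

Lemma exprq_sum (I : finType) (f : I -> F) :
  (\sum_i f i) ^+ q = \sum_i f i ^+ q.
Proof.
apply: (big_morph (fun a => a ^+ q) exprDq).
by rewrite expr0n; case: q prime_power_gt1.
Qed.

Lemma herm_conj N (x y : 'rV[F]_N) : herm q y x = herm q x y ^+ q.
Proof.
rewrite /herm exprq_sum; apply: eq_bigr => i _.
by rewrite exprMn exprqq mulrC.
Qed.

Lemma herm_eq0_sym N (x y : 'rV[F]_N) : (herm q y x == 0) = (herm q x y == 0).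
Proof. by rewrite herm_conj expf_eq0 (ltnW prime_power_gt1). Qed.

Lemma herm_suml N (I : finType) (c : I -> F) (x : I -> 'rV[F]_N) y :
  herm q (\sum_i c i *: x i) y = \sum_i c i * herm q (x i) y.
Proof.
rewrite /herm; under eq_bigr do rewrite summxE mulr_suml.
rewrite exchange_big; apply: eq_bigr => i _; rewrite mulr_sumr.
by apply: eq_bigr => l _; rewrite mxE mulrA.
Qed.

Lemma mem_herm_hull N (C : {vspace 'rV[F]_N}) x :
  reflect (x \in C /\ forall y, y \in C -> herm q x y = 0)
          (x \in herm_hull q C).
Proof.
rewrite memv_cap.
by apply: (iffP andP) => -[Cx /mem_herm_dual].
Qed.

Lemma primitive_elt_exists : exists z : F, (q ^ 2).-1.-primitive_root z.
Proof.
have q1 := prime_power_gt1.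
have Q_gt0 : (0 < (q ^ 2).-1)%N by nia.
pose rs := enum [pred x : F | x != 0].
have szrs : size rs = (q ^ 2).-1 by rewrite -cardE -cardF cardC1.
have /hasP[z _ hz] : has (q ^ 2).-1.-primitive_root rs; last by exists z.
apply: has_prim_root; rewrite ?enum_uniq ?szrs //.
apply/allP => x; rewrite mem_enum inE unity_rootE => x0.
rewrite -(inj_eq (mulfI x0)) -exprS prednK; last by nia.
by rewrite -cardF expf_card mulr1.
Qed.

(** A primitive element has order q^2 - 1 = (q - 1)(q + 1), which exceeds q + 1 once q > 2. *)
Lemma norm_neq1_exists : (2 < q)%N -> exists t : F, t != 0 /\ t ^+ q.+1 != 1.
Proof.
move=> q2; have [z hz] := primitive_elt_exists; exists z.
rewrite (prim_root_eq0 hz) -(prim_order_dvd hz); split; first nia.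
by apply/negP => /dvdn_leq; nia.
Qed.

(** For z primitive, the norm of z^((q-1)/2) is z^((q^2-1)/2): its square is 1, but it is not 1
    itself. *)
Lemma norm_eqN1_exists : odd q -> exists g : F, g != 0 /\ g ^+ q.+1 = -1.
Proof.
move=> q_odd; have q1 := prime_power_gt1.
have [z hz] := primitive_elt_exists; exists (z ^+ q./2).
split; first by rewrite expf_neq0 // (prim_root_eq0 hz); nia.
have /eqP : (z ^+ q./2 ^+ q.+1) ^+ 2 = 1.
  rewrite -!exprM; apply/eqP; rewrite -(prim_order_dvd hz).
  suff -> : (q./2 * (q.+1 * 2) = (q ^ 2).-1)%N by [].
  by have := odd_double_half q; rewrite q_odd; nia.
rewrite sqrf_eq1 => /orP[/eqP|/eqP //] /eqP.
rewrite -exprM -(prim_order_dvd hz) => /dvdn_leq.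
by have := odd_double_half q; rewrite q_odd; nia.
Qed.

(** Rescaling position [i] perturbs the form by a rank-one term in the [i]-th coordinates, so the
    new hull is the image of the hyperplane [y 0 i = 0] of the old one. *)
Lemma herm_hull_scale1 N (C : {vspace 'rV[F]_N}) :
    (2 < q)%N -> (0 < \dim (herm_hull q C))%N ->
  exists2 t : 'rV[F]_N, forall i, t 0 i != 0
    & \dim (herm_hull q (scale t @: C)) = (\dim (herm_hull q C)).-1.
Proof.
move=> q2; set H := herm_hull q C => dimH.
have [a [a0 a1]] := norm_neq1_exists q2.
have H0 : H != 0%VS by rewrite -dimv_eq0 -lt0n.
pose x := vpick H.
have Hx : x \in H by apply: memv_pick.
have /rV0Pn[i xi] : x != 0 by rewrite vpick0.
pose t : 'rV[F]_N := \row_l (if l == i then a else 1).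
have t0 l : t 0 l != 0 by rewrite mxE; case: ifP; rewrite ?oner_neq0.
pose ev : 'Hom('rV[F]_N, F^o) := linfun (fun y : 'rV[F]_N => y 0 i : F^o).
have evE y : ev y = y 0 i.
  have ev_lin : linear (fun y : 'rV[F]_N => y 0 i : F^o).
    by move=> c u w; rewrite !mxE.
  pose f := GRing.isLinear.Build _ _ _ _ _ ev_lin.
  pose g : {linear 'rV[F]_N -> F^o} := HB.pack (fun y : 'rV[F]_N => y 0 i : F^o) f.
  by rewrite (lfunE g).
exists t => //.
have herm_scale y z : herm q (scale t y) (scale t z) =
    herm q y z + (a ^+ q.+1 - 1) * (y 0 i * z 0 i ^+ q).
  rewrite /herm (bigD1 i) // [in RHS](bigD1 i) //=.
  rewrite !scaleE mxE eqxx (eq_bigr (fun l => y 0 l * z 0 l ^+ q)).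
    by rewrite exprMn exprS; ring.
  by move=> l li; rewrite !scaleE mxE (negPf li) !mulr1.
have -> : herm_hull q (scale t @: C) = (scale t @: (H :&: lker ev))%VS.
  apply/vspaceP => w; apply/mem_herm_hull/memv_imgP.
    move=> [/memv_imgP[y Cy ->] hy]; exists y => //.
    have [Cx hx] := mem_herm_hull _ _ Hx.
    (* Testing against the hull vector [x]: the old form vanishes, so only the perturbation is left,
       and [x 0 i != 0] forces [y 0 i = 0]. *)
    have yi : y 0 i = 0.
      have := hy _ (memv_img _ Cx); rewrite herm_scale.
      have /eqP -> : herm q y x == 0 by rewrite herm_eq0_sym hx.
      move/eqP; rewrite add0r !mulf_eq0 subr_eq0 (negPf a1) expf_eq0 (negPf xi).
      by rewrite andbF orbF => /eqP.
    rewrite memv_cap memv_ker evE yi eqxx andbT.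
    apply/mem_herm_hull; split=> // z Cz.
    by have := hy _ (memv_img _ Cz); rewrite herm_scale yi mul0r mulr0 addr0.
  move=> [y]; rewrite memv_cap memv_ker evE.
  move=> /andP[/mem_herm_hull[Cy hy] /eqP yi] ->.
  split=> [|_ /memv_imgP[z Cz ->]]; first exact: memv_img.
  by rewrite herm_scale yi hy // mul0r mulr0 addr0.
rewrite dim_limg_inj; last exact: scale_inj.
rewrite -(limg_ker_dim ev H).
(* The hyperplane is proper: [ev] takes values in a line and does not vanish at [x]. *)
suff -> : \dim (ev @: H) = 1 by rewrite addn1.
apply/eqP; rewrite eqn_leq; apply/andP; split.
  by rewrite (leq_trans (dimvS (subvf _))) // dimvf.
rewrite lt0n dimv_eq0; apply: contra xi => /eqP ev0.
by have := memv_img ev Hx; rewrite ev0 memv0 evE.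
Qed.

Lemma herm_hull_shrink N (C : {vspace 'rV[F]_N}) k d j :
    (2 < q)%N -> has_params C k d -> (j <= \dim (herm_hull q C))%N ->
  exists2 C' : {vspace 'rV[F]_N},
    has_params C' k d & \dim (herm_hull q C') = j.
Proof.
move=> q2; have [m] := ubnP (\dim (herm_hull q C)); elim: m C => // m IH C.
rewrite ltnS => Cm hC; rewrite leq_eqVlt => /predU1P[->|jC]; first by exists C.
have [|t t0 dimt] := @herm_hull_scale1 _ C q2; first by apply: leq_trans jC.
by apply: (IH (scale t @: C)%VS); [lia | exact: has_params_scale | lia].
Qed.

End HermitianHull.

(** * Locators as the roots of X^(n+1) - X; [n] is now the code length minus one *)

Section Locators.
Variables (F : finFieldType) (n : nat) (alpha : 'I_n.+1 -> F).
Hypotheses (n_gt0 : (0 < n)%N) (halpha : locators alpha).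

Lemma locators_expS i : alpha i ^+ n.+1 = alpha i.
Proof.
have [_ h1 h0] := halpha; have := ltn_ord i.
rewrite ltnS leq_eqVlt => /predU1P[/h0->|/h1 ai1]; first by rewrite expr0n.
by rewrite exprS ai1 mulr1.
Qed.

(** The n + 1 distinct locators already exhaust the roots of X^(n+1) - X; one more would exceed its
    degree. *)
Lemma locators_surj x : x ^+ n.+1 = x -> x \in codom alpha.
Proof.
have [a_inj _ _] := halpha; move=> xn; apply: contraT => xNa.
pose rs := x :: codom alpha; pose P : {poly F} := 'X^(n.+1) - 'X.
have sP : size P = n.+2 by rewrite size_polyDl size_polyXn // size_polyN size_polyX.
have := @max_poly_roots _ P rs; rewrite sP -size_poly_eq0 sP.
rewrite /= xNa map_inj_uniq ?enum_uniq // size_map size_enum_ord ltnn.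
suff -> : root P x && all (root P) (codom alpha) by move=> /(_ isT isT isT).
rewrite rootE !hornerE xn subrr eqxx /=.
apply/allP => _ /codomP[i ->].
by rewrite rootE !hornerE locators_expS subrr.
Qed.

(** The nonzero locators are n distinct n-th roots of unity in a field, hence a cyclic group of
    order n. *)
Lemma locators_primitive : exists w : F, n.-primitive_root w.
Proof.
have [a_inj h1 _] := halpha.
pose rs := [seq alpha (widen_ord (leqnSn n) i) | i : 'I_n].
have /hasP[w _ hw] : has n.-primitive_root rs; last by exists w.
apply: has_prim_root => //; last by rewrite size_map size_enum_ord.
  by apply/allP => _ /codomP[i ->]; rewrite unity_rootE h1 ?eqxx /=.
rewrite map_inj_uniq ?enum_uniq // => i j /a_inj /(congr1 val) ij.
exact: val_inj.
Qed.

(* Multiplication by a primitive root of unity permutes the locators and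
   preserves the weights, so it multiplies the sum by its [e]-th power. *)
Lemma sum_u_coef_expr e :
  ~~ (n %| e)%N -> \sum_(l < n.+1) u_coef alpha l * alpha l ^+ e = 0.
Proof.
have [w hw] := locators_primitive; have [a_inj _ _] := halpha.
have w0 : w != 0 by rewrite (prim_root_eq0 hw) -lt0n.
have w_mem i : w * alpha i \in codom alpha.
  apply: locators_surj.
  by rewrite exprMn locators_expS exprS (prim_expr_order hw) mulr1.
pose s i := iinv (w_mem i).
have sE i : alpha (s i) = w * alpha i by apply: f_iinv.
have s_inj : injective s.
  by move=> i j sij; apply/a_inj/(mulfI w0); rewrite -!sE sij.
(* Each of the n factors gains w^-1, and w^n = 1. *)
have su i : u_coef alpha (s i) = u_coef alpha i.
  rewrite /u_coef (reindex_inj s_inj) /=.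
  under eq_bigl do rewrite (inj_eq s_inj).
  under eq_bigr do rewrite !sE -mulrBr invfM.
  rewrite big_split prodr_const cardC1 card_ord /= exprVn.
  by rewrite (prim_expr_order hw) invr1 mul1r.
rewrite (prim_order_dvd hw) => we; set S := \sum_l _.
have : S = w ^+ e * S.
  rewrite {1}/S (reindex_inj s_inj) mulr_sumr; apply: eq_bigr => l _.
  by rewrite su sE exprMn mulrCA.
move/eqP; rewrite -[X in X == _]mul1r -subr_eq0 -mulrBl mulf_eq0 subr_eq0.
by rewrite eq_sym (negPf we) => /eqP.
Qed.

Lemma sum_root_lt_size (P : {poly F}) :
  P != 0 -> (\sum_(l < n.+1) root P (alpha l) < size P)%N.
Proof.
have [a_inj _ _] := halpha; move=> P0.
rewrite -big_mkcond sum1_card cardE -(size_map alpha).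
apply: max_poly_roots => //; last by rewrite map_inj_uniq ?enum_uniq.
by apply/allP => _ /mapP[l rl ->]; move: rl; rewrite mem_enum.
Qed.

End Locators.

(** * The doubly extended evaluation code, of dimension at least two *)

Section ExtendedCode.
Variables (F : finFieldType) (q n k : nat) (alpha v : 'I_n.+1 -> F).
Hypotheses (hq : prime_power q) (cardF : #|F| = (q ^ 2)%N).
Hypotheses (q_odd : odd q) (n_gt0 : (0 < n)%N) (k_le : (k.+2 <= n.+1)%N).
Hypotheses (halpha : locators alpha) (hv : multipliers q alpha v).
(** The exponent [b + a * q] is that of the Gram entry of rows [b] and [a]; off the diagonal it must
    avoid the multiples of [n]. *)
Hypothesis hgram : forall a b : 'I_k.+2, a != b -> ~~ (n %| b + a * q)%N.

Definition ext_gen (g : F) : 'M[F]_(k.+2, n.+1 + 2) :=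
  row_mx (\matrix_(a, l) (v l * alpha l ^+ a))
         (\matrix_(a, l) ((a == ord_max)%:R * (if l == 0 then 1 else g))).

Lemma ext_gen_lshift (g : F) (x : 'rV_k.+2) l :
  (x *m ext_gen g) 0 (lshift 2 l) = v l * (rVpoly x).[alpha l].
Proof.
rewrite mul_mx_row row_mxEl mxE horner_poly mulr_sumr.
by apply: eq_bigr => a _; rewrite mxE valK mulrCA.
Qed.

Lemma ext_gen_rshift (g : F) (x : 'rV_k.+2) (l : 'I_2) :
  (x *m ext_gen g) 0 (rshift n.+1 l) = x 0 ord_max * (if l == 0 then 1 else g).
Proof.
rewrite mul_mx_row row_mxEr mxE (bigD1 ord_max) //= mxE eqxx mul1r.
by rewrite big1 ?addr0 // => a /negPf aN; rewrite mxE aN mul0r mulr0.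
Qed.

Lemma zeros_ext_gen (g : F) (x : 'rV_k.+2) : g != 0 ->
  (\sum_(l < n.+1 + 2) ((x *m ext_gen g) 0 l == 0)%R =
   \sum_(l < n.+1) root (rVpoly x) (alpha l) + (x 0 ord_max == 0)%R * 2)%N.
Proof.
move=> g0; rewrite big_split_ord /=; congr (_ + _)%N.
  apply: eq_bigr => l _.
  by rewrite ext_gen_lshift mulf_eq0 (negPf (hv l).1).
rewrite !big_ord_recl big_ord0 !ext_gen_rshift /= !mulf_eq0 (negPf g0) oner_eq0.
by rewrite !orbF addn0 muln2 addnn.
Qed.

(** If the top coefficient is nonzero, the only zeros are at most k + 1 roots. If it vanishes, the
    degree drops to at most k, but both appended coordinates are zero, giving at most k + 2. *)
Lemma zeros_ext_gen_le (g : F) (x : 'rV_k.+2) : g != 0 -> x != 0 ->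
  (\sum_(l < n.+1 + 2) ((x *m ext_gen g) 0 l == 0)%R <= k.+2)%N.
Proof.
move=> g0 x0; rewrite zeros_ext_gen //.
have P0 : rVpoly x != 0.
  by apply: contra_neq x0 => P0; rewrite -[x]rVpolyK P0 linear0.
have sP : (size (rVpoly x) <= k.+2)%N by apply: size_poly.
have := sum_root_lt_size halpha P0; move: (\sum_(l < n.+1) _)%N => r r_lt.
case: eqP => x_top /=; last by lia.
have sP' : (size (rVpoly x) <= k.+1)%N.
  apply/leq_sizeP => i; rewrite leq_eqVlt => /predU1P[<-|ki].
    by rewrite (coef_rVpoly_ord x ord_max).
  by apply: nth_default; apply: leq_trans ki.
by lia.
Qed.

Lemma wt_ext_gen_ge (g : F) (x : 'rV_k.+2) : g != 0 -> x != 0 ->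
  (n.+1 - k.+2 + 2 <= wt (x *m ext_gen g))%N.
Proof.
move=> g0 x0; have := zeros_ext_gen_le g0 x0; have := wt_zeros (x *m ext_gen g).
by move: (wt _) (\sum_(l < _) _)%N => w r; lia.
Qed.

Lemma wt_ext_gen_min (g : F) : g != 0 ->
  exists2 x : 'rV_k.+2, x != 0 & wt (x *m ext_gen g) = (n.+1 - k.+2 + 2)%N.
Proof.
move=> g0; have kn : (k <= n.+1)%N by lia.
(* Degree exactly k with k locators as roots: the coefficient at k + 1 vanishes, so the two appended
   zeros bring the total to k + 2. *)
pose P := \prod_(l < n.+1 | (l < k)%N) ('X - (alpha l)%:P).
have sP : size P = k.+1.
  rewrite /P big_ord_narrow size_prod_XsubC.
  by have := size_enum_ord k; rewrite enumT => ->.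
have x_poly : rVpoly (poly_rV P : 'rV_k.+2) = P by rewrite poly_rV_K // sP.
have x0 : poly_rV P != 0 :> 'rV_k.+2.
  by apply/eqP => /(congr1 rVpoly) /eqP; rewrite x_poly linear0 -size_poly_eq0 sP.
exists (poly_rV P) => //.
apply/eqP; rewrite eqn_leq wt_ext_gen_ge // andbT.
have := wt_zeros (poly_rV P *m ext_gen g); rewrite zeros_ext_gen // x_poly.
rewrite mxE nth_default ?sP // eqxx mul1n.
suff : (k <= \sum_(l < n.+1) root P (alpha l))%N.
  by move: (wt _) (\sum_(l < _) _)%N => w r; lia.
have kE : (\sum_(l < n.+1 | (l < k)%N) 1 = k)%N.
  by rewrite (big_ord_narrow kn) sum1_card card_ord.
rewrite -[X in (X <= _)%N]kE big_mkcond.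
apply: leq_sum => l _; case: ltnP => // lk; rewrite lt0b.
by rewrite rootE /P (bigD1 l) //= hornerM !hornerE subrr mul0r.
Qed.

Lemma herm_ext_gen_row (g : F) a b : g ^+ q.+1 = -1 ->
  herm q (row b (ext_gen g)) (row a (ext_gen g)) =
    \sum_(l < n.+1) u_coef alpha l * alpha l ^+ (b + a * q).
Proof.
move=> gN; rewrite /herm big_split_ord /= [X in _ + X](_ : _ = 0) ?addr0.
  apply: eq_bigr => l _; rewrite ![row _ _ _ _]mxE !row_mxEl !mxE -(hv l).2.
  by rewrite exprMn exprS exprD exprM; ring.
(* The appended coordinates contribute a common factor times 1 + g^(q+1) = 0. *)
rewrite !big_ord_recl big_ord0 ![row _ _ _ _]mxE !row_mxEr !mxE /=.
rewrite !exprMn expr1n addr0 !mulr1 mulrACA -exprS gN.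
by rewrite mulrN1 subrr.
Qed.

Lemma ext_code_exists :
  exists2 C : {vspace 'rV[F]_(n.+1 + 2)},
    has_params C k.+2 (n.+1 - k.+2 + 2)
    & (k.+2 - #|Delta q alpha v k.+2| <= \dim (herm_hull q C))%N.
Proof.
have [g [g0 gN]] := norm_eqN1_exists hq cardF q_odd.
set G := ext_gen g; pose f : 'Hom('rV[F]_k.+2, 'rV[F]_(n.+1 + 2)) := linfun (mulmxr G).
have fE x : f x = x *m G by rewrite lfunE.
(* The weight bound gives injectivity: a nonzero [x] is sent to a word of weight at least 2. *)
have f_inj : injective f.
  move=> x y /eqP; rewrite !fE -subr_eq0 -mulmxBl => /eqP xy.
  apply/eqP; rewrite -subr_eq0; apply: contraT => /(wt_ext_gen_ge g0).
  by rewrite -/G xy wt0 addn2.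
have memC y : (y \in limg f) -> exists x, y = x *m G.
  by move=> /memv_imgP[x _ ->]; exists x.
have dimC : \dim (limg f) = k.+2.
  by rewrite dim_limg_inj // dimvf dim_matrix mul1r.
exists (limg f); first split=> //.
  apply: is_min_dist_wt.
    have [x x0 wx] := wt_ext_gen_min g0; exists (f x).
    by rewrite memv_img ?memvf // fE -/G wx -fE -[0](linear0 f) (inj_eq f_inj).
  move=> _ /memC[x ->] xG0; apply: wt_ext_gen_ge => //.
  by apply: contra_neq xG0 => ->; rewrite mul0mx.
have rowC a : row a G \in limg f.
  by rewrite rowE -fE memv_img ?memvf.
have row_hull (a : 'I_k.+2) :
    delta q alpha v a == 0 -> row a G \in herm_hull q (limg f).
  move=> /eqP da; apply/mem_herm_hull; split=> // _ /memC[x ->].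
  (* The form is linear in its first argument only, so the arguments are swapped before expanding
     along the rows. *)
  apply/eqP; rewrite -(herm_eq0_sym hq cardF) mulmx_sum_row herm_suml big1 // => b _.
  rewrite herm_ext_gen_row //; have [->|ab] := eqVneq b a.
    rewrite -[RHS](mulr0 (x 0 a)) -[in RHS]da; congr (_ * _).
    rewrite /delta; apply: eq_bigr => l _.
    by rewrite (hv l).2 mulnS.
  by rewrite sum_u_coef_expr ?mulr0 ?hgram 1?eq_sym.
rewrite leq_subLR [X in (_ <= X)%N]addnC -[X in (X <= _)%N]dimC.
pose D := [seq row a G | a in Delta q alpha v k.+2].
(* Rows with [delta] zero lie in the hull and the others are listed in [D], so the code is covered
   by the hull plus a span of dimension at most #Delta. *)
have sub : (limg f <= herm_hull q (limg f) + <<D>>)%VS.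
  apply/subvP => _ /memC[x ->]; rewrite mulmx_sum_row memv_suml // => a _.
  rewrite memvZ //; have [/row_hull|da] := boolP (delta q alpha v a == 0).
    by apply: (subvP (addvSl _ _)).
  apply: (subvP (addvSr _ _)); apply: memv_span.
  by apply: image_f; rewrite inE.
apply: leq_trans (dimvS sub) _; apply: leq_trans (dimv_add_leqif _ _) _.
by rewrite leq_add2l (leq_trans (dim_span _)) // size_map -cardE.
Qed.

End ExtendedCode.

(** * A self-orthogonal code of dimension one *)

Section LineCode.
Variables (F : finFieldType) (q m : nat).
Hypotheses (hq : prime_power q) (cardF : #|F| = (q ^ 2)%N) (q_odd : odd q).
Hypotheses (m_gt0 : (0 < m)%N) (m_even : ~~ odd m).

Lemma sum_sign_even : \sum_(i < m) (-1) ^+ i = 0 :> F.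
Proof.
rewrite -(odd_double_half m) (negPf m_even) add0n.
elim: m./2 => [|h IH]; first by rewrite big_ord0.
rewrite doubleS !big_ord_recr /= IH add0r exprS.
by rewrite mulN1r subrr.
Qed.

(* The coordinates have norms [1, -1, 1, -1, ..., 0], so the vector is
   self-orthogonal. *)
Lemma line_code_exists :
  exists2 C : {vspace 'rV[F]_m.+1},
    has_params C 1 m & (0 < \dim (herm_hull q C))%N.
Proof.
have [g [g0 gN]] := norm_eqN1_exists hq cardF q_odd.
pose x : 'rV[F]_m.+1 :=
  \row_i (if (i < m)%N then if odd i then g else 1 else 0).
have xl (i : 'I_m) : x 0 (widen_ord (leqnSn m) i) = if odd i then g else 1.
  by rewrite mxE /= ltn_ord.
have xr : x 0 ord_max = 0 by rewrite mxE ltnn.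
have wtx : wt x = m.
  have := wt_zeros x; rewrite big_ord_recr /= xr eqxx big1 ?addn1 => [[]|i _] //.
  by rewrite xl; case: odd; rewrite ?(negPf g0) ?oner_eq0.
have x0 : x != 0.
  by apply: contraTneq m_gt0 => x0; rewrite -wtx x0 wt0.
have hxx : herm q x x = 0.
  rewrite /herm big_ord_recr /= xr mul0r addr0 -[RHS]sum_sign_even.
  apply: eq_bigr => i _; rewrite xl -exprS -signr_odd.
  by case: odd; rewrite ?expr1n.
exists <[x]>%VS; first split.
- by rewrite dim_vline x0.
- apply: is_min_dist_wt; first by exists x; rewrite memv_line.
  move=> _ /vlineP[a ->]; rewrite scaler_eq0 negb_or => /andP[a0 _].
  rewrite -[X in (X <= _)%N]wtx /wt (eq_card (B := [set i | (a *: x) 0 i != 0])) //.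
  by move=> i; rewrite !inE [in RHS]mxE mulf_eq0 (negPf a0).
have : (<[x]> <= herm_hull q <[x]>)%VS.
  rewrite -memvE; apply/mem_herm_hull; split=> [|_ /vlineP[a ->]].
    exact: memv_line.
  apply/eqP; rewrite -(herm_eq0_sym hq cardF).
  suff -> : herm q (a *: x) x = a * herm q x x by rewrite hxx mulr0.
  by rewrite /herm mulr_sumr; apply: eq_bigr => i _; rewrite mxE mulrA.
by move/dimvS; rewrite dim_vline x0.
Qed.

End LineCode.

(** * Arithmetic of the parameters and the final assembly *)

(** By definition of the floor, 0 < k(q + 1) <= n + q - 1 < 2(n - 1), so the multiple of n - 1 can
    only be n - 1. *)
Lemma k_par_multiple (q n : nat) :
    (q.+1 < n)%N -> (n - 1 %| k_par q n * q.+1)%N ->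
  (n - 1 = k_par q n * q.+1)%N.
Proof.
move=> qn; have := leq_trunc_div (n + q - 1) q.+1; rewrite -/(k_par q n).
have : (0 < k_par q n)%N by rewrite divn_gt0; lia.
by move=> k0 kle /dvdnP[[|[|t]]]; nia.
Qed.

(** With a < b, reducing modulo q + 1 gives b = a + t(q + 1) with t >= 1, and the sum is (t + a)(q +
    1). Divisibility then yields t + a >= k, hence b = (t + a) + tq >= k + q, a contradiction. *)
Lemma gram_index_ndvd (q k a b : nat) :
    (1 < q)%N -> (0 < k)%N -> (k * q.+1 %| q ^ 2 - 1)%N ->
    (a < k + q)%N -> (b < k + q)%N -> a != b ->
  ~~ (k * q.+1 %| b + a * q)%N.
Proof.
move=> q1 k0 kdvd ak bk ab; apply/negP => h.
(* Since q^2 is 1 modulo k(q + 1), multiplying by q exchanges the roles of a and b. *)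
wlog lt_ab : a b ak bk {ab} h / (a < b)%N.
  move=> H; case: (ltngtP a b) ab => // [lt_ab|ba] _; first exact: (H a b).
  apply: (H b a) => //.
  rewrite -(@dvdn_addr (a * (q ^ 2 - 1))) ?dvdn_mull //.
  rewrite (_ : (_ + _ = q * (b + a * q))%N) ?dvdn_mull //.
  by rewrite mulnBr mulnDr muln1 -mulnn; nia.
have bE : (b + a * q = (b - a) + a * q.+1)%N by rewrite mulnS; lia.
have /dvdnP[t bt] : (q.+1 %| b - a)%N.
  rewrite -(@dvdn_addl (a * q.+1)) ?dvdn_mull // -bE.
  exact: dvdn_trans (dvdn_mull _ _) h.
have t_gt0 : (0 < t)%N by case: t bt => // bt; lia.
have tq := leq_pmull q t_gt0.
move: h; rewrite bE bt -mulnDl dvdn_pmul2r // => /dvdn_leq.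
by move: bt; rewrite mulnS; lia.
Qed.

(** Each argument of the minimum gives one bound: the first conclusion feeds [gram_index_ndvd], the
    second compares k' and q with n. *)
Lemma k_par_i_min_bounds (q n k' : nat) :
    k'%:Z <= (k_par q n)%:Z + i_min q n + 1 ->
  (k' <= k_par q n + q)%N /\ (k' * 2 + q <= n + 2)%N.
Proof.
rewrite /i_min; move: (k_par q n) => k.
lia.
Qed.

Theorem corollary7 (q n : nat) (F : finFieldType) (alpha v : 'I_n -> F)
    (hq : prime_power q) (cardF : #|F| = (q ^ 2)%N)
    (n_odd : odd n) (n_dvd : (n - 1 %| q ^ 2 - 1)%N)
    (halpha : locators alpha) (hv : multipliers q alpha v)
    (k_dvd : (n - 1 %| k_par q n * q.+1)%N)
    (k' : nat) (k'_ge1 : (1 <= k')%N)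
    (k'_le : k'%:Z <= (k_par q n)%:Z + i_min q n + 1)
    (j : nat) (hj : (j <= k' - #|Delta q alpha v k'|)%N) :
  exists C : {vspace 'rV[F]_(n + 2)},
    [/\ has_params C k' (n - k' + 2)%N,
        AMDS C
      & \dim (herm_hull q C) = j].
Proof.
have q1 := prime_power_gt1 hq.
(* For n = 1 the divisor n - 1 is 0, which would force q^2 = 1. *)
have n3 : (2 < n)%N.
  case: n n_odd n_dvd {alpha v halpha hv k_dvd k'_le hj} => [|[|[|n]]] // _.
  by rewrite dvd0n => /eqP; nia.
(* The even number n - 1 divides q^2 - 1. *)
have q_odd : odd q.
  have : (2 %| q ^ 2 - 1)%N.
    apply: dvdn_trans n_dvd.
    by rewrite dvdn2 oddB ?n_odd // ltnW // ltnW.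
  by rewrite dvdn2 oddB ?oddX //; [case: odd | nia].
have q2 : (2 < q)%N by case: q q1 q_odd {hq cardF n_dvd hv k_dvd k'_le hj} => [|[|[|q]]].
have [k'_kq k'_n] := k_par_i_min_bounds k'_le.
suff [C Cpar Chull] : exists2 C : {vspace 'rV[F]_(n + 2)},
    has_params C k' (n - k' + 2)
    & (k' - #|Delta q alpha v k'| <= \dim (herm_hull q C))%N.
  have [C' C'par C'hull] :=
    herm_hull_shrink hq cardF q2 Cpar (leq_trans hj Chull).
  exists C'; split=> //.
  by exists k', (n - k' + 2)%N; split=> //; lia.
(* Dimension one is separate: nonzero words of the extended code would have no zero coordinate, and
   the distance would be too large by one. *)
have [k'1|k'_gt1] := leqP k' 1.
  have -> : k' = 1%N by lia.
  have n1_even : ~~ odd n.+1 by rewrite /= n_odd.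
  have [C Cpar Chull] := line_code_exists hq cardF q_odd (ltn0Sn n) n1_even.
  rewrite (_ : n - 1 + 2 = n.+1)%N ?addn2; last by lia.
  exists C => //.
  by apply: leq_trans Chull; rewrite leq_subr.
(* From k' >= 2 and 2k' + q <= n + 2 follows n >= q + 2. *)
have [qn k_gt0] : (q.+1 < n)%N /\ (0 < k_par q n)%N.
  by split; [lia | rewrite divn_gt0; lia].
have nE := k_par_multiple qn k_dvd.
case: k' k'_gt1 {k'_ge1 hj k'_le} k'_kq k'_n => [|[|k]] // _ k'_kq k'_n.
case: n alpha v n3 n_dvd halpha hv k'_kq k'_n nE {n_odd k_dvd} qn k_gt0
  => // n alpha v n3; rewrite subn1 /=.
move=> n_dvd halpha hv k'_kq k'_n nE qn k_gt0.
apply: ext_code_exists => //; [lia | lia |].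
move=> a b ab; rewrite nE; apply: gram_index_ndvd => //; rewrite -?nE //.
- by apply: leq_trans (ltn_ord a) _.
- by apply: leq_trans (ltn_ord b) _.
Qed.
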